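(* Let $G$ be a linear oriented hypergraph with incidence dual $G^*$ and intersection graph $\Lambda(G)$. Then $A(G^* )=A(\Lambda(G))$.
   Context: A hypergraph $H=(V,E,\mathcal I)$ consists of a finite set $V$ of vertices, a finite family $E=(e_\iota)_{\iota\in\Omega}$ of subsets of $V$ (the edges; an edge may be empty, and edges with different indices are regarded as different even if they coincide as sets) and its incidences $\mathcal I$. All hypergraphs are simple: each vertex $v\in e$ is incident with $e$ exactly once, so $\mathcal I=\{(v,e): v\in e\}$. $H$ is linear if $|e\cap f|\le 1$ for any two edges $e,f$ with distinct indices. An oriented hypergraph is a pair $G=(H,\sigma)$ with $\sigma:\mathcal I\to\{+1,-1\}$; hypergraph terminology for $G$ refers to $H$. For an oriented hypergraph with vertices $v_1,\dots,v_n$, an edge $e$ and distinct $v_i,v_j\in e$, put $\mathrm{sgn}_e(v_i,v_j)=-\sigma(v_i,e)\sigma(v_j,e)$. The adjacency matrix $A=(a_{ij})\in\mathbb R^{n\times n}$ has $a_{ij}=\sum_{e}\mathrm{sgn}_e(v_i,v_j)$ for $i\ne j$, the sum being over all edges $e$ containing both $v_i$ and $v_j$ (so $a_{ij}=0$ if there are none), and $a_{ii}=0$. The incidence dual $G^*$ has vertex set $E$ and edge family $V$, where $e$ is incident with $v$ in $G^*$ iff $v$ is incident with $e$ in $G$; its orientation is $\sigma^*(e,v)=\sigma(v,e)$. Intersection graph: for a linear $G$, $\Lambda(G)$ is the oriented hypergraph with vertex set $E(G)$ (ordered as in $G^*$) and one edge $ef=\{e,f\}$ for each pair of distinct $e,f\in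 E(G)$ with $e\cap f\ne\varnothing$; if $v\in e\cap f$ then $\sigma_{\Lambda(G)}(e,ef)=\sigma_G(v,e)$ and $\sigma_{\Lambda(G)}(f,ef)=\sigma_G(v,f)$. *)

(* Defs.v *)
From mathcomp Require Import all_boot all_order all_algebra.
From mathcomp Require Import reals.

Set Implicit Arguments.
Unset Strict Implicit.
Unset Printing Implicit Defensive.

Import GRing.Theory.
Local Open Scope ring_scope.

(* [V] is the vertex set and [E] the index set of the edge family, so edges
   with distinct indices are distinct even when they coincide as sets. The
   orientation is a total function: its values are +1 or -1 on incidences, and
   its values at non-incident pairs carry no meaning. *)
Record oriented_hypergraph (V E : finType) := OrientedHypergraph {
  edge : E -> {set V};
  orient : V -> E -> int;
  orientP : forall v e, v \in edge e -> orient v e = 1 \/ orient v e = -1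
}.

Definition linear_hypergraph (V E : finType) (G : oriented_hypergraph V E) :
    Prop :=
  forall e f : E, e != f -> (#|edge G e :&: edge G f| <= 1)%N.

Definition sgn (V E : finType) (G : oriented_hypergraph V E) (e : E)
    (u v : V) : int :=
  - (orient G u e * orient G v e).

(* Rows and columns follow the enumeration [enum_val] of the vertex type, so
   hypergraphs on the same vertex type have their vertices in the same order. *)
Definition adjacency_mx (R : realType) (V E : finType)
    (G : oriented_hypergraph V E) : 'M[R]_#|V| :=
  \matrix_(i < #|V|, j < #|V|)
    if i == j then 0
    else \sum_(e : E | (enum_val i \in edge G e) && (enum_val j \in edge G e))
           (sgn G e (enum_val i) (enum_val j))%:~R.

Section Dual.
Variables (V E : finType) (G : oriented_hypergraph V E).

Definition dual_edge (v : V) : {set E} := [set e | v \in edge G e].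

Definition dual_orient (e : E) (v : V) : int := orient G v e.

Lemma dual_orientP e v :
  e \in dual_edge v -> dual_orient e v = 1 \/ dual_orient e v = -1.
Proof. by rewrite inE; apply: orientP. Qed.

Definition incidence_dual : oriented_hypergraph E V :=
  OrientedHypergraph dual_orientP.

End Dual.

Section IntersectionGraph.
Variables (V E : finType) (G : oriented_hypergraph V E).

Definition is_crossing (S : {set E}) : bool :=
  [exists e, exists f,
    [&& e != f, edge G e :&: edge G f != set0 & S == [set e; f]]].

Definition crossing : finType := {S : {set E} | is_crossing S}.

Definition crossing_edge (S : crossing) : {set E} := val S.

(* For [S = {e, f}] the vertex picked lies in both [e] and [f]. Such a vertex
   exists for every [S : crossing], and it is unique when [G] is linear; the
   default value 1 is never reached. *)
Definition crossing_orient (e : E) (S : crossing) : int :=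
  if [pick v | [forall g in val S, v \in edge G g]] is Some v
  then orient G v e else 1.

Lemma crossing_orientP e (S : crossing) :
  e \in crossing_edge S ->
  crossing_orient e S = 1 \/ crossing_orient e S = -1.
Proof.
move=> eS; rewrite /crossing_orient; case: pickP => [v /forall_inP vS|_].
  exact/orientP/vS.
by left.
Qed.

Definition intersection_graph : oriented_hypergraph E crossing :=
  OrientedHypergraph crossing_orientP.

End IntersectionGraph.

(* Main.v *)
Require Import Defs.
From mathcomp Require Import all_boot all_order all_algebra.
From mathcomp Require Import reals.

(** Fix distinct edges [e] and [f]. If they are disjoint, no vertex lies in
    both and no edge of the intersection graph joins them, so both entries
    vanish. Otherwise, by linearity, exactly one vertex [v] lies in both, and
    [{e, f}] is the only edge of the intersection graph joining them; the two
    sums have a single term each, and these agree because the intersection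
    graph inherits its signs at [{e, f}] from those at [v]. *)

Set Implicit Arguments.
Unset Strict Implicit.
Unset Printing Implicit Defensive.

Import GRing.Theory.
Local Open Scope ring_scope.

Section Crossings.
Variables (V E : finType) (G : oriented_hypergraph V E).

Lemma linear_common_vertex (linG : linear_hypergraph G) (e f : E) (u v : V) :
  e != f -> v \in edge G e -> v \in edge G f ->
  (u \in edge G e) && (u \in edge G f) = (u == v).
Proof.
move=> ef ve vf; apply/andP/eqP => [[ue uf]|-> //].
by apply: (card_le1_eqP (linG e f ef)); rewrite inE ?ue ?uf ?ve ?vf.
Qed.

(** A crossing has only two elements, so two distinct ones exhaust it. *)
Lemma crossing_pair (S : crossing G) (e f : E) :
  e != f -> e \in val S -> f \in val S ->
  val S = [set e; f] /\ edge G e :&: edge G f != set0.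
Proof.
case: S => S /= /existsP[a /existsP[b /and3P[_ ab /eqP->]]].
(* Of the four cases, two contradict [e != f]; the other two differ by swapping [a] and [b]. *)
rewrite !inE => ef /orP[]/eqP Ee /orP[]/eqP Ef; move: ef ab;
  rewrite {}Ee {}Ef ?eqxx // => _ ab; split=> //; first exact: setUC.
by rewrite setIC.
Qed.

(** Linearity leaves [v] as the only vertex that [pick] can return. *)
Lemma crossing_orientE (linG : linear_hypergraph G) (S : crossing G)
    (e f : E) (v : V) :
  e != f -> val S = [set e; f] -> v \in edge G e -> v \in edge G f ->
  forall g, crossing_orient g S = orient G v g.
Proof.
move=> ef Sef ve vf g; rewrite /crossing_orient Sef.
case: pickP => [u /forall_inP uS|/(_ v)/forall_inP[h]].
  suff /eqP-> : u == v by [].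
  by rewrite -(linear_common_vertex linG u ef ve vf) // !uS ?set21 ?set22.
(* The default branch is absurd, since [v] satisfies the predicate. *)
by rewrite !inE => /orP[]/eqP->.
Qed.

Lemma crossing_pairP (e f : E) (v : V) :
  e != f -> v \in edge G e -> v \in edge G f -> is_crossing G [set e; f].
Proof.
move=> ef ve vf; apply/existsP; exists e; apply/existsP; exists f.
by rewrite ef eqxx andbT; apply/set0Pn; exists v; rewrite inE ve.
Qed.

End Crossings.

Theorem corollary4p2 (R : realType) (V E : finType)
    (G : oriented_hypergraph V E) (linG : linear_hypergraph G) :
  adjacency_mx R (incidence_dual G) = adjacency_mx R (intersection_graph G).
Proof.
apply/matrixP => i j; rewrite !mxE; case: eqVneq => // ij.
have ef : enum_val i != enum_val j by rewrite (inj_eq enum_val_inj).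
move: (enum_val i) (enum_val j) ef => e f ef {i j ij}.
have [ef0|[v /setIP[ve vf]]] := set_0Vmem (edge G e :&: edge G f).
  rewrite !big_pred0 // => [S|v]; last by rewrite !inE -in_setI ef0 inE.
  by apply/andP=> -[eS fS]; have [_] := crossing_pair ef eS fS;
    rewrite ef0 eqxx.
pose S : crossing G := Sub [set e; f] (crossing_pairP ef ve vf).
rewrite (big_pred1 v) => [|u]; last first.
  by rewrite !inE (linear_common_vertex linG u ef ve vf).
(* Crossings are sets, not ordered pairs, so [[set e; f]] is counted once. *)
rewrite (big_pred1 S) => [|T]; last first.
  apply/andP/eqP => [[eT fT]|->]; last by rewrite /= set21 set22.
  by apply/val_inj; have [->] := crossing_pair ef eT fT.
by rewrite /sgn /= !(crossing_orientE linG ef (erefl : val S = [set e; f]) ve vf).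
Qed.
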